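(* Assume $\mathit{Rid}$ and $\mathit{Lid}$ are infinite sets. Let $s_1$ be a reachable global state, $r,r'\in\mathit{Rid}$, and suppose $s_1\to_r s_2$ and $s_1\to_{r'} s_2'$. Then there exist global states $s_3,s_3'$ such that $s_2\to_{r'}^= s_3$, $s_3\approx s_3'$ and $s_2'\to_r^= s_3'$.
   Context: Revision calculus. Fix sets $\mathit{Var}$, $\mathit{Rid}$ (revision identifiers), $\mathit{Lid}$ (location identifiers), and constants $\mathit{Const}\ni \mathsf{unit},\mathsf{true},\mathsf{false}$. Values $v ::= c \mid x \mid l \mid r \mid \lambda x.e$ and expressions $e ::= v \mid e\ e \mid e\ ?\ e : e \mid \mathsf{ref}\ e \mid !e \mid e := e \mid \mathsf{rfork}\ e \mid \mathsf{rjoin}\ e$ (syntax trees, no $\alpha$-equivalence). Evaluation contexts $\mathcal{E} ::= \square \mid \mathcal{E}\ e \mid v\ \mathcal{E} \mid \mathcal{E}\ ?\ e : e \mid \mathsf{ref}\ \mathcal{E} \mid !\mathcal{E} \mid \mathcal{E} := e \mid l := \mathcal{E} \mid \mathsf{rjoin}\ \mathcal{E}$; $\mathcal{E}[e]$ is plugging $e$ into the hole. Partial functions: $\epsilon$ is the empty partial function; $f(x\mapsto y)$ is update, $f(x\mapsto\bot)$ removes $x$ from the domain; $f :: g$ maps $x$ to $g\,x$ if $x\in\mathsf{dom}\,g$ and to $f\,x$ otherwise. A store is a partial function $\mathit{Lid}\rightharpoonup\mathit{Val}$; a local state is a triple $\langle\sigma,\tau,e\rangle$ of two stores and an expression. A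 global state is a partial function $s:\mathit{Rid}\rightharpoonup$ LocalState. Occurrences: $\mathit{RID}\ e$, $\mathit{LID}\ e$ are the sets of revision/location identifiers occurring in an expression; for a store $\mathit{RID}\,\sigma = \bigcup_{v\in\mathsf{ran}\,\sigma}\mathit{RID}\,v$ and $\mathit{LID}\,\sigma=\mathsf{dom}\,\sigma\cup\bigcup_{v\in\mathsf{ran}\,\sigma}\mathit{LID}\,v$; for a local state $\mathit{RID}\langle\sigma,\tau,e\rangle=\mathit{RID}\,\sigma\cup\mathit{RID}\,\tau\cup\mathit{RID}\,e$, likewise $\mathit{LID}$; for a global state $\mathit{RID}\,s=\mathsf{dom}\,s\cup\bigcup_{L\in\mathsf{ran}\,s}\mathit{RID}\,L$ and $\mathit{LID}\,s=\bigcup_{L\in\mathsf{ran}\,s}\mathit{LID}\,L$. Renaming: for $\alpha:\mathit{Rid}\to\mathit{Rid}$ and $\beta:\mathit{Lid}\to\mathit{Lid}$, $\mathcal{R}\,\alpha\,\beta\,S$ renames every revision identifier in a structure $S$ (value, expression, context) by $\alpha$ and every location identifier by $\beta$ (variables unchanged); for a store and bijective $\beta$, $(\mathcal{R}\,\alpha\,\beta\,\sigma)(\beta\,l)=\mathcal{R}\,\alpha\,\beta\,(\sigma\,l)$ (undefined iff $\sigma\,l$ undefined); local states are renamed componentwise; for a global state and bijective $\alpha$, $(\mathcal{R}\,\alpha\,\beta\,s)(\alpha\,r)=\mathcal{R}\,\alpha\,\beta\,(s\,r)$. $S\approx S'$ iff there are bijections $\alpha,\beta$ with $\mathcal{R}\,\alpha\,\beta\,S=S'$.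 Substitution: a fixed function $\mathsf{subst}$ with $[v/x]e := \mathsf{subst}\ v\ x\ e$, assumed only to satisfy $\mathcal{R}\,\alpha\,\beta\,(\mathsf{subst}\ e\ x\ e')=\mathsf{subst}\,(\mathcal{R}\,\alpha\,\beta\,e)\,x\,(\mathcal{R}\,\alpha\,\beta\,e')$, $\mathit{RID}(\mathsf{subst}\ e\ x\ e')\subseteq\mathit{RID}\,e\cup\mathit{RID}\,e'$ and $\mathit{LID}(\mathsf{subst}\ e\ x\ e')\subseteq\mathit{LID}\,e\cup\mathit{LID}\,e'$. Transition relation $s\to_r s'$ (writing $s\llbracket r\mapsto L\rrbracket$ for ''a global state $s$ with $s\,r=L$''): (apply) $s\llbracket r\mapsto\langle\sigma,\tau,\mathcal{E}[(\lambda x.e)\,v]\rangle\rrbracket\to_r s(r\mapsto\langle\sigma,\tau,\mathcal{E}[[v/x]e]\rangle)$; (if-true) $\mathcal{E}[\mathsf{true}\ ?\ e_1:e_2]$ steps to $\mathcal{E}[e_1]$, (if-false) $\mathcal{E}[\mathsf{false}\ ?\ e_1:e_2]$ to $\mathcal{E}[e_2]$, stores unchanged; (new) $s\llbracket r\mapsto\langle\sigma,\tau,\mathcal{E}[\mathsf{ref}\,v]\rangle\rrbracket\to_r s(r\mapsto\langle\sigma,\tau(l\mapsto v),\mathcal{E}[l]\rangle)$ if $l\notin\mathit{LID}\,s$; (get) $s\llbracket r\mapsto\langle\sigma,\tau,\mathcal{E}[!l]\rangle\rrbracket\to_r s(r\mapsto\langle\sigma,\tau,\mathcal{E}[(\sigma::\tau)\,l]\rangle)$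 if $l\in\mathsf{dom}(\sigma::\tau)$; (set) $s\llbracket r\mapsto\langle\sigma,\tau,\mathcal{E}[l:=v]\rangle\rrbracket\to_r s(r\mapsto\langle\sigma,\tau(l\mapsto v),\mathcal{E}[\mathsf{unit}]\rangle)$ if $l\in\mathsf{dom}(\sigma::\tau)$; (fork) $s\llbracket r\mapsto\langle\sigma,\tau,\mathcal{E}[\mathsf{rfork}\,e]\rangle\rrbracket\to_r s(r\mapsto\langle\sigma,\tau,\mathcal{E}[r']\rangle, r'\mapsto\langle\sigma::\tau,\epsilon,e\rangle)$ if $r'\notin\mathit{RID}\,s$; (join) if $s\,r=\langle\sigma,\tau,\mathcal{E}[\mathsf{rjoin}\,r']\rangle$ and $s\,r'=\langle\sigma',\tau',v\rangle$ with $v$ a value, then $s\to_r s(r\mapsto\langle\sigma,\tau::\tau',\mathcal{E}[\mathsf{unit}]\rangle, r'\mapsto\bot)$; (join$_\epsilon$) if $s\,r=\langle\sigma,\tau,\mathcal{E}[\mathsf{rjoin}\,r']\rangle$ and $r'\notin\mathsf{dom}\,s$, then $s\to_r\epsilon$. $\to_r^=$ is the reflexive closure of $\to_r$. Let $\to=\bigcup_{r}\to_r$, $\to^*$ its reflexive transitive closure. A program expression is an expression $e$ with $\mathit{RID}\,e=\mathit{LID}\,e=\varnothing$; an initial state is $\epsilon(r\mapsto\langle\epsilon,\epsilon,e\rangle)$ for some $r\in\mathit{Rid}$ and program expression $e$; $s'$ is reachable if $s\to^*s'$ for some initial state $s$. *)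

(* Defs.v *)
From mathcomp Require Import all_boot.
From mathcomp Require Import boolp classical_sets cardinality.
From Stdlib Require Export Relation_Operators.

Set Implicit Arguments.
Unset Strict Implicit.
Unset Printing Implicit Defensive.

Local Open Scope classical_set_scope.

Section PartialFunctions.
Context {A B : Type}.

Definition pfun (A B : Type) : Type := A -> option B.

Definition pempty : pfun A B := fun=> None.

Definition pset (f : pfun A B) (x : A) (y : B) : pfun A B :=
  fun x' => if `[< x' = x >] then Some y else f x'.

Definition premove (f : pfun A B) (x : A) : pfun A B :=
  fun x' => if `[< x' = x >] then None else f x'.

(* [poverride f g] is f :: g, in which g takes precedence. *)
Definition poverride (f g : pfun A B) : pfun A B :=
  fun x => if g x is Some y then Some y else f x.

Definition dom (f : pfun A B) : set A := [set x | exists y, f x = Some y].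
Definition ran (f : pfun A B) : set B := [set y | exists x, f x = Some y].

(* The partial function h conjugated by a and b, i.e. b \o h \o a^-1. It is
   only meaningful for bijective a, where [prenameE] characterizes it; points
   outside the image of a are sent to bottom. *)
Definition prename (a : A -> A) (b : B -> B) (h : pfun A B) : pfun A B :=
  fun y => match pselect (exists x, a x = y) with
           | left e => omap b (h (projT1 (cid e)))
           | right _ => None
           end.

Lemma prenameE (a : A -> A) (b : B -> B) (h : pfun A B) (x : A) :
  bijective a -> prename a b h (a x) = omap b (h x).
Proof.
move=> /bij_inj a_inj; rewrite /prename.
case: pselect => [e|[]]; last by exists x.
by case: (cid e) => x' /= /a_inj ->.
Qed.

End PartialFunctions.

Section Calculus.
Context {Const Var Rid Lid : Type}.

Inductive value : Type :=
  | VConst of Const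
  | VVar of Var
  | VLoc of Lid
  | VRid of Rid
  | VLam of Var & expr
with expr : Type :=
  | EVal of value
  | EApp of expr & expr
  | EIf of expr & expr & expr
  | ERef of expr
  | EGet of expr
  | ESet of expr & expr
  | EFork of expr
  | EJoin of expr.

Inductive ectx : Type :=
  | CHole
  | CAppL of ectx & expr
  | CAppR of value & ectx
  | CIf of ectx & expr & expr
  | CRef of ectx
  | CGet of ectx
  | CSetL of ectx & expr
  | CSetR of Lid & ectx
  | CJoin of ectx.

Fixpoint plug (E : ectx) (e : expr) : expr :=
  match E with
  | CHole => e
  | CAppL E e' => EApp (plug E e) e'
  | CAppR v E => EApp (EVal v) (plug E e)
  | CIf E e1 e2 => EIf (plug E e) e1 e2
  | CRef E => ERef (plug E e)
  | CGet E => EGet (plug E e)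
  | CSetL E e' => ESet (plug E e) e'
  | CSetR l E => ESet (EVal (VLoc l)) (plug E e)
  | CJoin E => EJoin (plug E e)
  end.

Definition store : Type := pfun Lid value.

Record lstate : Type := LState {
  snapshot : store;
  local : store;
  current : expr
}.

Definition gstate : Type := pfun Rid lstate.

Fixpoint RIDv (v : value) : set Rid :=
  match v with
  | VConst _ | VVar _ | VLoc _ => set0
  | VRid r => [set r]
  | VLam _ e => RIDe e
  end
with RIDe (e : expr) : set Rid :=
  match e with
  | EVal v => RIDv v
  | EApp e1 e2 | ESet e1 e2 => RIDe e1 `|` RIDe e2
  | EIf e1 e2 e3 => RIDe e1 `|` RIDe e2 `|` RIDe e3
  | ERef e1 | EGet e1 | EFork e1 | EJoin e1 => RIDe e1
  end.

Fixpoint LIDv (v : value) : set Lid :=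
  match v with
  | VConst _ | VVar _ | VRid _ => set0
  | VLoc l => [set l]
  | VLam _ e => LIDe e
  end
with LIDe (e : expr) : set Lid :=
  match e with
  | EVal v => LIDv v
  | EApp e1 e2 | ESet e1 e2 => LIDe e1 `|` LIDe e2
  | EIf e1 e2 e3 => LIDe e1 `|` LIDe e2 `|` LIDe e3
  | ERef e1 | EGet e1 | EFork e1 | EJoin e1 => LIDe e1
  end.

Definition RIDstore (s : store) : set Rid := \bigcup_(v in ran s) RIDv v.
Definition LIDstore (s : store) : set Lid :=
  dom s `|` \bigcup_(v in ran s) LIDv v.

Definition RIDl (L : lstate) : set Rid :=
  RIDstore (snapshot L) `|` RIDstore (local L) `|` RIDe (current L).
Definition LIDl (L : lstate) : set Lid :=
  LIDstore (snapshot L) `|` LIDstore (local L) `|` LIDe (current L).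

Definition RIDg (s : gstate) : set Rid :=
  dom s `|` \bigcup_(L in ran s) RIDl L.
Definition LIDg (s : gstate) : set Lid := \bigcup_(L in ran s) LIDl L.

Section Renaming.
Context (a : Rid -> Rid) (b : Lid -> Lid).

Fixpoint renamev (v : value) : value :=
  match v with
  | VConst c => VConst c
  | VVar x => VVar x
  | VLoc l => VLoc (b l)
  | VRid r => VRid (a r)
  | VLam x e => VLam x (renamee e)
  end
with renamee (e : expr) : expr :=
  match e with
  | EVal v => EVal (renamev v)
  | EApp e1 e2 => EApp (renamee e1) (renamee e2)
  | EIf e1 e2 e3 => EIf (renamee e1) (renamee e2) (renamee e3)
  | ERef e1 => ERef (renamee e1)
  | EGet e1 => EGet (renamee e1)
  | ESet e1 e2 => ESet (renamee e1) (renamee e2)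
  | EFork e1 => EFork (renamee e1)
  | EJoin e1 => EJoin (renamee e1)
  end.

Definition rename_store (s : store) : store := prename b renamev s.

Definition renamel (L : lstate) : lstate :=
  LState (rename_store (snapshot L)) (rename_store (local L))
         (renamee (current L)).

Definition renameg (s : gstate) : gstate := prename a renamel s.

End Renaming.

Definition gequiv (s s' : gstate) : Prop :=
  exists (a : Rid -> Rid) (b : Lid -> Lid),
    [/\ bijective a, bijective b & renameg a b s = s'].

Definition substitution (subst : expr -> Var -> expr -> expr) : Prop :=
  [/\ forall a b e x e',
        renamee a b (subst e x e') = subst (renamee a b e) x (renamee a b e'),
      forall e x e', RIDe (subst e x e') `<=` RIDe e `|` RIDe e'
    & forall e x e', LIDe (subst e x e') `<=` LIDe e `|` LIDe e'].

Context (cunit ctrue cfalse : Const) (subst : expr -> Var -> expr -> expr).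

Inductive step (r : Rid) (s : gstate) : gstate -> Prop :=
  | step_apply S T E x e v :
      s r = Some (LState S T
                    (plug E (EApp (EVal (VLam x e)) (EVal v)))) ->
      step r s (pset s r (LState S T (plug E (subst (EVal v) x e))))
  | step_if_true S T E e1 e2 :
      s r = Some (LState S T (plug E (EIf (EVal (VConst ctrue)) e1 e2))) ->
      step r s (pset s r (LState S T (plug E e1)))
  | step_if_false S T E e1 e2 :
      s r = Some (LState S T (plug E (EIf (EVal (VConst cfalse)) e1 e2))) ->
      step r s (pset s r (LState S T (plug E e2)))
  | step_new S T E v l :
      s r = Some (LState S T (plug E (ERef (EVal v)))) ->
      ~ LIDg s l ->
      step r s (pset s r (LState S (pset T l v) (plug E (EVal (VLoc l)))))
  | step_get S T E l v :
      s r = Some (LState S T (plug E (EGet (EVal (VLoc l))))) ->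
      poverride S T l = Some v ->
      step r s (pset s r (LState S T (plug E (EVal v))))
  | step_set S T E l v :
      s r = Some (LState S T (plug E (ESet (EVal (VLoc l)) (EVal v)))) ->
      dom (poverride S T) l ->
      step r s (pset s r (LState S (pset T l v)
                            (plug E (EVal (VConst cunit)))))
  | step_fork S T E e r' :
      s r = Some (LState S T (plug E (EFork e))) ->
      ~ RIDg s r' ->
      step r s (pset (pset s r (LState S T (plug E (EVal (VRid r')))))
                     r' (LState (poverride S T) pempty e))
  | step_join S T E r' S' T' v :
      s r = Some (LState S T (plug E (EJoin (EVal (VRid r'))))) ->
      s r' = Some (LState S' T' (EVal v)) ->
      step r s (premove (pset s r (LState S (poverride T T')
                                     (plug E (EVal (VConst cunit)))))
                        r')
  | step_join_eps S T E r' :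
      s r = Some (LState S T (plug E (EJoin (EVal (VRid r'))))) ->
      ~ dom s r' ->
      step r s pempty.

Definition program_expr (e : expr) : Prop := RIDe e = set0 /\ LIDe e = set0.

Definition initial_state (s : gstate) : Prop :=
  exists r e, program_expr e /\ s = pset pempty r (LState pempty pempty e).

Definition any_step (s s' : gstate) : Prop := exists r, step r s s'.

Definition reachable (s' : gstate) : Prop :=
  exists s, initial_state s /\ clos_refl_trans gstate any_step s s'.

End Calculus.

Arguments value : clear implicits.
Arguments expr : clear implicits.
Arguments ectx : clear implicits.
Arguments store : clear implicits.
Arguments lstate : clear implicits.
Arguments gstate : clear implicits.

(* Main.v *)
Require Import Defs.
From mathcomp Require Import all_boot.
From mathcomp Require Import boolp classical_sets cardinality.

(** A step of a revision is determined, up to the choice of a fresh identifier,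
    by the local state of that revision and by the state of the revision it
    joins. Hence two steps of the same revision lead to states that differ by
    the swap of two fresh identifiers. For two different revisions, reachable
    states mention finitely many identifiers, so the second step may first be
    renamed to allocate an identifier that the first does not use; steps are
    equivariant, so this costs only a renaming of the final state. The two
    steps then write to disjoint revisions and commute, unless one fails (it
    still fails after the other step) or both join the same revision (the
    second join then fails, in either order). *)

Local Open Scope classical_set_scope.

Set Implicit Arguments.
Unset Strict Implicit.

(** * Transpositions, and bijections avoiding a finite set *)

Section Swap.
Context {A : Type}.

Definition swap (x y z : A) : A :=
  if `[< z = x >] then y else if `[< z = y >] then x else z.

Lemma swapL x y : swap x y x = y.
Proof. by rewrite /swap; case: asboolP. Qed.

Lemma swapD x y z : z <> x -> z <> y -> swap x y z = z.
Proof. by rewrite /swap; case: asboolP => // _; case: asboolP. Qed.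

Lemma swap_bij x y : bijective (swap x y).
Proof.
apply: inv_bij => z; rewrite /swap; case: (asboolP (z = x)) => [->|zx].
  by case: asboolP => [->//|_]; case: asboolP.
case: (asboolP (z = y)) => [->|zy]; first by case: asboolP.
by case: asboolP => // _; case: asboolP.
Qed.

Lemma id_bij : bijective (@id A).
Proof. by exists id. Qed.

(** [N] is meant as the identifier that an action allocates, if any, [X] as the identifiers of the
    state and [Y] as those to be avoided. As [A] is infinite, some [z] lies outside [X] and [Y];
    exchanging the element of [N] with [z] moves nothing in [X], since neither of the two belongs to
    it. *)
Lemma exists_avoiding_bij (X Y N : set A) :
  infinite_set [set: A] -> finite_set X -> finite_set Y ->
  (forall x y, N x -> N y -> x = y) -> (forall x, N x -> ~ X x) ->
  exists a, [/\ bijective a, forall x, X x -> a x = x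
              & forall x, N x -> ~ Y (a x)].
Proof.
move=> infA finX finY N1 NX.
have [[y Ny]|N0] := pselect (exists y, N y); last first.
  by exists id; split=> [|//|x Nx]; [exact: id_bij|case: N0; exists x].
have /infinite_setN0 [z [_ XYz]] : infinite_set ([set: A] `\` (X `|` Y)).
  by apply: infinite_setD => //; rewrite finite_setU.
exists (swap y z); split=> [|x Xx|x Nx]; first exact: swap_bij.
  apply: swapD => xE; first by apply: (NX y); rewrite // -xE.
  by apply: XYz; left; rewrite -xE.
by rewrite (N1 _ _ Nx Ny) swapL => Yz; apply: XYz; right.
Qed.

End Swap.

(** * Conjugation of partial functions by bijections *)

Section PartialFunctions.
Context {A B : Type} (a : A -> A) (b : B -> B).
Hypothesis a_bij : bijective a.
Implicit Types f g : pfun A B.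

(** Since [a] is surjective, it suffices to compare both sides at points [a x], where [prenameE]
    computes the left one. *)
Lemma prename_eq f g :
  (forall x, omap b (f x) = g (a x)) -> prename a b f = g.
Proof.
move=> fg; apply/funext => y; have [a' _ aK] := a_bij.
by rewrite -(aK y) prenameE.
Qed.

Lemma asbool_bij x y : `[< a x = a y >] = `[< x = y >].
Proof. by apply: asbool_equiv_eq; split=> [/(bij_inj a_bij)|->]. Qed.

Lemma prename_pset f x y :
  prename a b (pset f x y) = pset (prename a b f) (a x) (b y).
Proof.
apply: prename_eq => z; rewrite /pset asbool_bij prenameE //.
by case: asboolP.
Qed.

Lemma prename_premove f x :
  prename a b (premove f x) = premove (prename a b f) (a x).
Proof.
apply: prename_eq => z; rewrite /premove asbool_bij prenameE //.
by case: asboolP.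
Qed.

Lemma prename_pempty : prename a b (@pempty A B) = @pempty A B.
Proof. exact: prename_eq. Qed.

Lemma prename_poverride f g :
  prename a b (poverride f g) = poverride (prename a b f) (prename a b g).
Proof.
apply: prename_eq => z; rewrite /poverride !prenameE //.
by case: (g z).
Qed.

Lemma prename_fix f :
  (forall x, dom f x -> a x = x) -> (forall y, ran f y -> b y = y) ->
  prename a b f = f.
Proof.
move=> fix_a fix_b; apply: prename_eq => x.
case fx: (f x) => [y|] /=.
  by rewrite fix_b ?fix_a ?fx; [| exists y | exists x].
(* Outside the domain of [f] nothing says that [a] fixes [x]. But if [a x] were in the domain, [a]
   would fix [a x], and injectivity would give [a x = x]. *)
case fax: (f (a x)) => [y|] //.
have /(bij_inj a_bij) axx : a (a x) = a x by apply: fix_a; exists y.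
by rewrite axx fx in fax.
Qed.

End PartialFunctions.

Scheme value_expr_ind := Induction for value Sort Prop
  with expr_value_ind := Induction for expr Sort Prop.
Combined Scheme value_expr_mutind from value_expr_ind, expr_value_ind.

Section Calculus.
Context {Const Var Rid Lid : Type}.
Local Notation value := (value Const Var Rid Lid).
Local Notation expr := (expr Const Var Rid Lid).
Local Notation ectx := (ectx Const Var Rid Lid).
Local Notation store := (store Const Var Rid Lid).
Local Notation lstate := (lstate Const Var Rid Lid).
Local Notation gstate := (gstate Const Var Rid Lid).
Implicit Types (v : value) (e : expr) (E : ectx) (S T : store)
  (L : lstate) (s : gstate) (r q : Rid) (l : Lid).

(** * Unique decomposition into a context and a redex *)

(** Only the shape is tested: any constant may be the condition, and the location read or written
    may be undefined. Unique decomposition already holds for this larger class. *)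
Definition redex e : bool :=
  match e with
  | EApp (EVal (VLam _ _)) (EVal _) | EIf (EVal (VConst _)) _ _
  | ERef (EVal _) | EGet (EVal (VLoc _)) | ESet (EVal (VLoc _)) (EVal _)
  | EFork _ | EJoin (EVal (VRid _)) => true
  | _ => false
  end.

Lemma plug_redexNval E e v : redex e -> plug E e <> EVal v.
Proof. by case: E => //=; case: e. Qed.

(** The evaluation positions of a redex are filled by values, and a context filled with a redex is
    never a value. *)
Lemma redex_plug E e : redex e -> redex (plug E e) -> E = CHole.
Proof.
move=> re; case: E => [|E e0|[c|x|l|q|x e0] E|E e1 e2|E|E|E e0|l E|E] //=.
all: by case: (plug E e) (@plug_redexNval E e ^~ re) => //= v /(_ v).
Qed.

(** Induction on [E] against the head of [E']. When the two contexts descend into different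
    arguments, one of them has a value where the other has a plugged redex, which [nval] and [nval']
    exclude; a hole against a proper context is excluded by [redex_plug]. *)
Lemma plug_redex_inj E E' e e' : redex e -> redex e' ->
  plug E e = plug E' e' -> E = E' /\ e = e'.
Proof.
move=> re re'.
have nval E0 v : plug E0 e <> EVal v by exact: plug_redexNval.
have nval' E0 v : EVal v <> plug E0 e' by move/esym; exact: plug_redexNval.
have hole E0 : plug E0 e = e' -> E0 = CHole.
  by move=> eE; apply: (redex_plug re); rewrite eE.
elim: E E' => [|E IH e0|v E IH|E IH e1 e2|E IH|E IH|E IH e0|l E IH|E IH] E'.
  move=> /= eE; have E0 : E' = CHole by apply: (redex_plug re'); rewrite -eE.
  by rewrite eE E0.
all: case: E' => [/hole//|E' e0'|v' E'|E' e1' e2'|E'|E'|E' e0'|l' E'|E'] //=.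
all: (by case=> /IH[-> ->] *; subst) || (by case=> /nval) ||
     (by case=> /nval') || (by case=> -> /IH[-> ->]).
Qed.

(** * Renaming *)

Section Renaming.
Context {a : Rid -> Rid} {b : Lid -> Lid}.

Fixpoint renamec (E : ectx) : ectx :=
  match E with
  | CHole => CHole
  | CAppL E e => CAppL (renamec E) (renamee a b e)
  | CAppR v E => CAppR (renamev a b v) (renamec E)
  | CIf E e1 e2 => CIf (renamec E) (renamee a b e1) (renamee a b e2)
  | CRef E => CRef (renamec E)
  | CGet E => CGet (renamec E)
  | CSetL E e => CSetL (renamec E) (renamee a b e)
  | CSetR l E => CSetR (b l) (renamec E)
  | CJoin E => CJoin (renamec E)
  end.

Lemma renamee_plug E e :
  renamee a b (plug E e) = plug (renamec E) (renamee a b e).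
Proof.
by elim: E => //= [E ->|v E ->|E ->|E ->|E ->|E ->|l E ->|E ->].
Qed.

Lemma rename_fix :
  (forall v, (forall q, RIDv v q -> a q = q) ->
     (forall l, LIDv v l -> b l = l) -> renamev a b v = v) /\
  (forall e, (forall q, RIDe e q -> a q = q) ->
     (forall l, LIDe e l -> b l = l) -> renamee a b e = e).
Proof.
apply: value_expr_mutind => //=.
- by move=> l _ ->.
- by move=> q ->.
- by move=> x e IH fa fb; rewrite IH.
- by move=> v IH fa fb; rewrite IH.
- by move=> e1 IH1 e2 IH2 fa fb; rewrite IH1 ?IH2 // => z ez;
    (apply: fa + apply: fb); (by left) || (by right).
- by move=> e1 IH1 e2 IH2 e3 IH3 fa fb; rewrite IH1 ?IH2 ?IH3 // => z ez;
    (apply: fa + apply: fb);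
    (by right) || (by left; left) || (by left; right).
- by move=> e IH fa fb; rewrite IH.
- by move=> e IH fa fb; rewrite IH.
- by move=> e1 IH1 e2 IH2 fa fb; rewrite IH1 ?IH2 // => z ez;
    (apply: fa + apply: fb); (by left) || (by right).
- by move=> e IH fa fb; rewrite IH.
- by move=> e IH fa fb; rewrite IH.
Qed.

Hypotheses (a_bij : bijective a) (b_bij : bijective b).

Lemma rename_store_fix T : (forall q, RIDstore T q -> a q = q) ->
  (forall l, LIDstore T l -> b l = l) -> rename_store a b T = T.
Proof.
move=> fa fb; apply: prename_fix => // [l Tl|v Tv]; first by apply: fb; left.
by apply: rename_fix.1 => z vz; [apply: fa|apply: fb; right]; exists v.
Qed.

Lemma renamel_fix L : (forall q, RIDl L q -> a q = q) ->
  (forall l, LIDl L l -> b l = l) -> renamel a b L = L.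
Proof.
case: L => S T e fa fb; rewrite /renamel /= !rename_store_fix ?rename_fix.2 //;
  by move=> z ?; (apply: fa || apply: fb);
  (by right) || (by left; left) || (by left; right).
Qed.

Lemma renameg_fix s : (forall q, RIDg s q -> a q = q) ->
  (forall l, LIDg s l -> b l = l) -> renameg a b s = s.
Proof.
move=> fa fb; apply: prename_fix => // [q sq|L sL]; first by apply: fa; left.
by apply: renamel_fix => z Lz; [apply: fa; right|apply: fb]; exists L.
Qed.

(** Injectivity of [a] makes occurrence reflect along renaming. Contrapositively, an identifier that
    is fresh stays fresh after renaming, which transports the side conditions of allocation. *)
Lemma RID_rename :
  (forall v q, RIDv (renamev a b v) (a q) -> RIDv v q) /\
  (forall e q, RIDe (renamee a b e) (a q) -> RIDe e q).
Proof.
apply: value_expr_mutind => //=.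
- by move=> q q' /(bij_inj a_bij).
- by move=> e1 IH1 e2 IH2 q [/IH1|/IH2]; [left|right].
- by move=> e1 IH1 e2 IH2 e3 IH3 q [[/IH1|/IH2]|/IH3];
    [left; left|left; right|right].
- by move=> e1 IH1 e2 IH2 q [/IH1|/IH2]; [left|right].
Qed.

Lemma LID_rename :
  (forall v l, LIDv (renamev a b v) (b l) -> LIDv v l) /\
  (forall e l, LIDe (renamee a b e) (b l) -> LIDe e l).
Proof.
apply: value_expr_mutind => //=.
- by move=> l l' /(bij_inj b_bij).
- by move=> e1 IH1 e2 IH2 l [/IH1|/IH2]; [left|right].
- by move=> e1 IH1 e2 IH2 e3 IH3 l [[/IH1|/IH2]|/IH3];
    [left; left|left; right|right].
- by move=> e1 IH1 e2 IH2 l [/IH1|/IH2]; [left|right].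
Qed.

Lemma ran_prename (A B : Type) (f : A -> A) (g : B -> B) (h : pfun A B) y :
  bijective f -> ran (prename f g h) y -> exists2 z, ran h z & y = g z.
Proof.
move=> f_bij [x]; have [f' _ fK] := f_bij; rewrite -(fK x) prenameE //.
by case hx: (h (f' x)) => [z|] //= [<-]; exists z => //; exists (f' x).
Qed.

Lemma dom_prename (A B : Type) (f : A -> A) (g : B -> B) (h : pfun A B) x :
  bijective f -> dom (prename f g h) (f x) -> dom h x.
Proof.
move=> f_bij [y]; rewrite prenameE //.
by case hx: (h x) => [z|] //= _; exists z.
Qed.

Lemma RIDstore_rename T q :
  RIDstore (rename_store a b T) (a q) -> RIDstore T q.
Proof.
by case=> v /(ran_prename b_bij)[v' Tv' ->] /RID_rename.1; exists v'.
Qed.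

Lemma LIDstore_rename T l :
  LIDstore (rename_store a b T) (b l) -> LIDstore T l.
Proof.
case=> [/(dom_prename b_bij)|]; first by left.
by case=> v /(ran_prename b_bij)[v' Tv' ->] /LID_rename.1; right; exists v'.
Qed.

Lemma RIDg_rename s q : RIDg (renameg a b s) (a q) -> RIDg s q.
Proof.
case=> [/(dom_prename a_bij)|]; first by left.
case=> L /(ran_prename a_bij)[L' sL' ->] H; right; exists L' => //.
case: H => [[|]/RIDstore_rename|/RID_rename.2]; first by left; left.
  by left; right.
by right.
Qed.

Lemma LIDg_rename s l : LIDg (renameg a b s) (b l) -> LIDg s l.
Proof.
case=> L /(ran_prename a_bij)[L' sL' ->] H; exists L' => //.
case: H => [[|]/LIDstore_rename|/LID_rename.2]; first by left; left.
  by left; right.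
by right.
Qed.

End Renaming.

(** * Occurring identifiers *)

(** Stating the bound with an arbitrary superset [X] expresses that the context contributes only
    elements of [X] without defining occurrences in contexts. The bounds for stores and states below
    have the same form, so that they compose. *)
Lemma RIDe_plug E e (X : set Rid) : RIDe (plug E e) `<=` X ->
  RIDe e `<=` X /\ forall e', RIDe e' `<=` X -> RIDe (plug E e') `<=` X.
Proof.
elim: E => [|E IH e0|v E IH|E IH e1 e2|E IH|E IH|E IH e0|l E IH|E IH] //=;
  rewrite ?subUset.
- by move=> [/IH[? IH'] ?]; split=> // e' /IH' ?; rewrite subUset.
- by move=> [? /IH[? IH']]; split=> // e' /IH' ?; rewrite subUset.
- by move=> [[/IH[? IH'] ?] ?]; split=> // e' /IH' ?; rewrite !subUset.
- by move=> [/IH[? IH'] ?]; split=> // e' /IH' ?; rewrite subUset.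
- by move=> [? /IH[? IH']]; split=> // e' /IH' ?; rewrite subUset.
Qed.

Lemma LIDe_plug E e (X : set Lid) : LIDe (plug E e) `<=` X ->
  LIDe e `<=` X /\ forall e', LIDe e' `<=` X -> LIDe (plug E e') `<=` X.
Proof.
elim: E => [|E IH e0|v E IH|E IH e1 e2|E IH|E IH|E IH e0|l E IH|E IH] //=;
  rewrite ?subUset.
- by move=> [/IH[? IH'] ?]; split=> // e' /IH' ?; rewrite subUset.
- by move=> [? /IH[? IH']]; split=> // e' /IH' ?; rewrite subUset.
- by move=> [[/IH[? IH'] ?] ?]; split=> // e' /IH' ?; rewrite !subUset.
- by move=> [/IH[? IH'] ?]; split=> // e' /IH' ?; rewrite subUset.
- by move=> [? /IH[? IH']]; split=> // e' /IH' ?; rewrite subUset.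
Qed.

Lemma RIDstore_pset T l v (X : set Rid) : RIDstore T `<=` X ->
  RIDv v `<=` X -> RIDstore (pset T l v) `<=` X.
Proof.
move=> TX vX q [v' [l']]; rewrite /pset; case: asboolP => _ Tv' v'q.
  by case: Tv' v'q => <-; apply: vX.
by apply: TX; exists v' => //; exists l'.
Qed.

Lemma RIDstore_poverride S T (X : set Rid) : RIDstore S `<=` X ->
  RIDstore T `<=` X -> RIDstore (poverride S T) `<=` X.
Proof.
move=> SX TX q [v [l]]; rewrite /poverride.
case Tl: (T l) => [v'|] lv vq; last by apply: SX; exists v => //; exists l.
by apply: TX; exists v => //; exists l; rewrite Tl.
Qed.

Lemma RIDstore_pempty : RIDstore (@pempty Lid value) = set0.
Proof. by apply/seteqP; split=> // q [v [l]]. Qed.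

Lemma RIDl_sub S T e (X : set Rid) : RIDl (LState S T e) `<=` X <->
  [/\ RIDstore S `<=` X, RIDstore T `<=` X & RIDe e `<=` X].
Proof. by rewrite /RIDl !subUset; split=> [[[]]|[]]. Qed.

Lemma RIDg_pset s r L (X : set Rid) : RIDg s `<=` X -> X r ->
  RIDl L `<=` X -> RIDg (pset s r L) `<=` X.
Proof.
move=> sX Xr LX q [[L' ]|[L' [r']]]; rewrite /pset; case: asboolP.
- by move=> ->.
- by move=> _ sq; apply: sX; left; exists L'.
- by move=> _ [<-]; apply: LX.
- by move=> _ sr' L'q; apply: sX; right; exists L' => //; exists r'.
Qed.

Lemma RIDg_premove s r (X : set Rid) : RIDg s `<=` X ->
  RIDg (premove s r) `<=` X.
Proof.
move=> sX q [[L' ]|[L' [r']]]; rewrite /premove; case: asboolP => // _ sq.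
  by apply: sX; left; exists L'.
by move=> L'q; apply: sX; right; exists L' => //; exists r'.
Qed.

Lemma RIDg_at s r L : s r = Some L -> RIDl L `<=` RIDg s.
Proof. by move=> sr q Lq; right; exists L => //; exists r. Qed.

Lemma LIDstore_pset T l v (X : set Lid) : LIDstore T `<=` X -> X l ->
  LIDv v `<=` X -> LIDstore (pset T l v) `<=` X.
Proof.
move=> TX Xl vX q [[v']|[v' [l']]]; rewrite /pset; case: asboolP.
- by move=> ->.
- by move=> _ Tq; apply: TX; left; exists v'.
- by move=> _ [<-]; apply: vX.
- by move=> _ Tl' v'q; apply: TX; right; exists v' => //; exists l'.
Qed.

Lemma LIDstore_poverride S T (X : set Lid) : LIDstore S `<=` X ->
  LIDstore T `<=` X -> LIDstore (poverride S T) `<=` X.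
Proof.
move=> SX TX q [[v]|[v [l]]]; rewrite /poverride.
  case Tq: (T q) => [v'|] qv; last by apply: SX; left; exists v.
  by apply: TX; left; exists v'.
case Tl: (T l) => [v'|] lv vq.
  by apply: TX; right; exists v => //; exists l; rewrite Tl.
by apply: SX; right; exists v => //; exists l.
Qed.

Lemma LIDstore_pempty : LIDstore (@pempty Lid value) = set0.
Proof. by apply/seteqP; split=> // q [[v]|[v [l]]]. Qed.

Lemma LIDl_sub S T e (X : set Lid) : LIDl (LState S T e) `<=` X <->
  [/\ LIDstore S `<=` X, LIDstore T `<=` X & LIDe e `<=` X].
Proof. by rewrite /LIDl !subUset; split=> [[[]]|[]]. Qed.

Lemma LIDg_pset s r L (X : set Lid) : LIDg s `<=` X ->
  LIDl L `<=` X -> LIDg (pset s r L) `<=` X.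
Proof.
move=> sX LX l [L' [r']]; rewrite /pset; case: asboolP => _ sr' L'l.
  by case: sr' L'l => <-; apply: LX.
by apply: sX; exists L' => //; exists r'.
Qed.

Lemma LIDg_premove s r (X : set Lid) : LIDg s `<=` X ->
  LIDg (premove s r) `<=` X.
Proof.
move=> sX l [L' [r']]; rewrite /premove; case: asboolP => // _ sr' L'l.
by apply: sX; exists L' => //; exists r'.
Qed.

Lemma LIDg_at s r L : s r = Some L -> LIDl L `<=` LIDg s.
Proof. by move=> sr l Ll; exists L => //; exists r. Qed.

(** * Steps as actions *)

(* The outcome of a step, detached from the global state it is taken in:
   a local step with the location it allocates, if any; a fork of [r] with the
   new local states of the forking revision and of [r]; a join of [r], whose
   local store it reads; and a failing join of [r]. *)
Inductive action : Type :=
  | ALocal of option Lid & lstate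
  | AFork (r : Rid) of lstate & lstate
  | AJoin (r : Rid) of store & lstate
  | AFail (r : Rid).
Implicit Types act : action.

Definition perform r act s : gstate :=
  match act with
  | ALocal _ L => pset s r L
  | AFork q L L' => pset (pset s r L) q L'
  | AJoin q _ L => premove (pset s r L) q
  | AFail _ => pempty
  end.

Definition new_rid act : set Rid :=
  if act is AFork q _ _ then [set q] else set0.
Definition new_lid act : set Lid :=
  if act is ALocal (Some l) _ then [set l] else set0.
Definition joined act : set Rid :=
  if act is AJoin q _ _ then [set q] else set0.

(** The condition that a step puts on the revision it joins. In the case [AJoin] it also ties the
    store recorded in the action to the actual local store of that revision. *)
Definition joinable s act : Prop :=
  match act with
  | AJoin q T _ => exists S v, s q = Some (LState S T (EVal v))
  | AFail q => ~ dom s q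
  | _ => True
  end.

Definition renamea (a : Rid -> Rid) (b : Lid -> Lid) act : action :=
  match act with
  | ALocal o L => ALocal (omap b o) (renamel a b L)
  | AFork q L L' => AFork (a q) (renamel a b L) (renamel a b L')
  | AJoin q T L => AJoin (a q) (rename_store a b T) (renamel a b L)
  | AFail q => AFail (a q)
  end.

Lemma renamea_id act : renamea id id act = act.
Proof.
have lid L : renamel id id L = L by apply: renamel_fix => //; exact: id_bij.
have sid T : rename_store id id T = T.
  by apply: rename_store_fix => //; exact: id_bij.
by case: act => [[l|]|||] //= *; rewrite ?lid ?sid.
Qed.

Lemma perform_rename a b r act s : bijective a ->
  renameg a b (perform r act s) =
  perform (a r) (renamea a b act) (renameg a b s).
Proof.
move=> a_bij; case: act => [o L|q L L'|q T L|q] /=; rewrite /renameg.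
- exact: prename_pset.
- by rewrite !prename_pset.
- by rewrite prename_premove // prename_pset.
- exact: prename_pempty.
Qed.

Lemma new_rid_rename a b act q : new_rid (renamea a b act) q ->
  exists2 q', new_rid act q' & q = a q'.
Proof. by case: act => [[l|]|||] //= q' _ _ ->; exists q'. Qed.

Lemma new_lid_rename a b act l : new_lid (renamea a b act) l ->
  exists2 l', new_lid act l' & l = b l'.
Proof. by case: act => [[l'|]|||] //= _ ->; exists l'. Qed.

Section Semantics.
Context (cunit ctrue cfalse : Const) (subst : expr -> Var -> expr -> expr).
Local Notation step := (step cunit ctrue cfalse subst).

(** The part of each rule that concerns the acting revision alone. The allocated identifier, the
    joined store and the choice between joining and failing are left open; the fields of [enabled]
    constrain them by the global state. *)
Inductive effect : lstate -> action -> Prop :=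
  | effect_apply S T E x e v :
      effect (LState S T (plug E (EApp (EVal (VLam x e)) (EVal v))))
        (ALocal None (LState S T (plug E (subst (EVal v) x e))))
  | effect_if_true S T E e1 e2 :
      effect (LState S T (plug E (EIf (EVal (VConst ctrue)) e1 e2)))
        (ALocal None (LState S T (plug E e1)))
  | effect_if_false S T E e1 e2 :
      effect (LState S T (plug E (EIf (EVal (VConst cfalse)) e1 e2)))
        (ALocal None (LState S T (plug E e2)))
  | effect_new S T E v l :
      effect (LState S T (plug E (ERef (EVal v))))
        (ALocal (Some l) (LState S (pset T l v) (plug E (EVal (VLoc l)))))
  | effect_get S T E l v :
      poverride S T l = Some v ->
      effect (LState S T (plug E (EGet (EVal (VLoc l)))))
        (ALocal None (LState S T (plug E (EVal v))))
  | effect_set S T E l v :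
      dom (poverride S T) l ->
      effect (LState S T (plug E (ESet (EVal (VLoc l)) (EVal v))))
        (ALocal None (LState S (pset T l v) (plug E (EVal (VConst cunit)))))
  | effect_fork S T E e q :
      effect (LState S T (plug E (EFork e)))
        (AFork q (LState S T (plug E (EVal (VRid q))))
                 (LState (poverride S T) pempty e))
  | effect_join S T E q T' :
      effect (LState S T (plug E (EJoin (EVal (VRid q)))))
        (AJoin q T' (LState S (poverride T T')
                       (plug E (EVal (VConst cunit)))))
  | effect_fail S T E q :
      effect (LState S T (plug E (EJoin (EVal (VRid q))))) (AFail q).

Record enabled r s act (L : lstate) : Prop := Enabled {
  enabled_at : s r = Some L;
  enabled_effect : effect L act;
  enabled_new_rid : forall q, new_rid act q -> ~ RIDg s q;
  enabled_new_lid : forall l, new_lid act l -> ~ LIDg s l;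
  enabled_joinable : joinable s act
}.

(** With the converse [enabled_step], this lets the commutation argument distinguish four kinds of
    actions in place of nine rules. *)
Lemma step_enabled r s s' : step r s s' ->
  exists act L, enabled r s act L /\ s' = perform r act s.
Proof.
case.
- move=> S T E x e v sr; do 2 eexists.
  by split; [split; [exact: sr|exact: effect_apply| | |]|].
- move=> S T E e1 e2 sr; do 2 eexists.
  by split; [split; [exact: sr|exact: effect_if_true| | |]|].
- move=> S T E e1 e2 sr; do 2 eexists.
  by split; [split; [exact: sr|exact: effect_if_false| | |]|].
- move=> S T E v l sr fl; do 2 eexists.
  by split; [split; [exact: sr|exact: effect_new| |move=> _ ->|]|].
- move=> S T E l v sr STl; do 2 eexists.
  by split; [split; [exact: sr|exact: effect_get STl| | |]|].
- move=> S T E l v sr STl; do 2 eexists.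
  by split; [split; [exact: sr|exact: effect_set STl| | |]|].
- move=> S T E e q sr fq; do 2 eexists.
  by split; [split; [exact: sr|exact: effect_fork|move=> _ ->| |]|].
- move=> S T E q S' T' v sr sq; do 2 eexists.
  by split; [split; [exact: sr|exact: effect_join| | |exists S', v; exact: sq]|].
- move=> S T E q sr sq; do 2 eexists.
  by split; [split; [exact: sr|exact: effect_fail| | |exact: sq]|].
Qed.

Lemma enabled_step r s act L : enabled r s act L -> step r s (perform r act s).
Proof.
case=> sr eff; case: eff sr => /=.
- by move=> *; apply: step_apply.
- by move=> S T E e1 e2 sr _ _ _; apply: step_if_true sr.
- by move=> S T E e1 e2 sr _ _ _; apply: step_if_false sr.
- by move=> S T E v l sr _ fl _; apply: step_new => //; apply: fl.
- by move=> S T E l v STl sr _ _ _; apply: step_get STl.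
- by move=> S T E l v STl sr _ _ _; apply: step_set STl.
- by move=> S T E e q sr fq _ _; apply: step_fork => //; apply: fq.
- by move=> S T E q T' sr _ _ [S' [v sq]]; apply: step_join sq.
- by move=> S T E q sr _ _ sq; apply: step_join_eps sr sq.
Qed.

Lemma effectNval L act v : effect L act -> current L <> EVal v.
Proof. by case=> *; exact: plug_redexNval. Qed.

(** * Equivariance of steps, and growth of the occurring identifiers *)

Hypothesis subst_ok : substitution subst.

(** Every operation in the rules commutes with renaming; for the substitution in [effect_apply] this
    is the first clause of [subst_ok]. *)
Lemma effect_rename a b L act : bijective b ->
  effect L act -> effect (renamel a b L) (renamea a b act).
Proof.
have [substE _ _] := subst_ok => b_bij.
case=> [S T E x e v|S T E e1 e2|S T E e1 e2|S T E v l|S T E l v STl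
       |S T E l v [v' STl]|S T E e q|S T E q T'|S T E q];
  rewrite /= /renamel /= !renamee_plug /= ?substE /rename_store
    ?prename_pset // ?prename_poverride // ?prename_pempty //;
  constructor; rewrite -prename_poverride //.
  by rewrite prenameE // STl.
by exists (renamev a b v'); rewrite prenameE // STl.
Qed.

Lemma enabled_rename a b r s act L : bijective a -> bijective b ->
  enabled r s act L ->
  enabled (a r) (renameg a b s) (renamea a b act) (renamel a b L).
Proof.
move=> a_bij b_bij [sr eff fr fl jn]; split.
- by rewrite /renameg prenameE // sr.
- exact: effect_rename.
- by move=> _ /new_rid_rename[q Nq ->] /RIDg_rename - /(_ a_bij b_bij); apply: fr.
- by move=> _ /new_lid_rename[l Nl ->] /LIDg_rename - /(_ a_bij b_bij); apply: fl.
case: act jn {eff fr fl} => //= [q T _ [S [v sq]]|q sq].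
  exists (rename_store a b S), (renamev a b v).
  by rewrite /renameg prenameE // sq.
by move/(dom_prename a_bij).
Qed.

Lemma step_rename a b r s s' : bijective a -> bijective b ->
  step r s s' -> step (a r) (renameg a b s) (renameg a b s').
Proof.
move=> a_bij b_bij /step_enabled[act [L [en ->]]].
by rewrite perform_rename //; apply: enabled_step (enabled_rename _ _ en).
Qed.

(** The new local states are assembled from pieces of old ones, from substitution, which introduces
    no identifier, and from the allocated identifier. A join moves a store that already occurs in
    [s]. *)
Lemma perform_RIDg r s act L : enabled r s act L ->
  RIDg (perform r act s) `<=` RIDg s `|` new_rid act.
Proof.
case=> sr eff _ _ jn; set X := _ `|` _.
have sX : RIDg s `<=` X by move=> q; left.
have NX : new_rid act `<=` X by move=> q; right.
have LX := subset_trans (RIDg_at sr) sX.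
have Xr : X r by left; left; exists L.
have [_ substR _] := subst_ok.
(* From here only the inclusions into [X] matter, so its definition is forgotten. *)
clearbody X; case: eff LX jn NX {sr} => [S T E x e v|S T E e1 e2|S T E e1 e2|S T E v l
       |S T E l v STl|S T E l v [v' STl]|S T E e q|S T E q T'|S T E q];
  move=> /RIDl_sub[SX TX /RIDe_plug[/= eX EX]] jn NX.
- apply: RIDg_pset => //; apply/RIDl_sub; split=> //.
  move: eX; rewrite subUset => -[eX vX].
  by apply: EX; apply: subset_trans (substR _ _ _) _; rewrite subUset.
- apply: RIDg_pset => //; apply/RIDl_sub; split=> //.
  by move: eX; rewrite !subUset => -[[_ e1X] _]; apply: EX.
- apply: RIDg_pset => //; apply/RIDl_sub; split=> //.
  by move: eX; rewrite !subUset => -[_ e2X]; apply: EX.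
- apply: RIDg_pset => //; apply/RIDl_sub; split=> //.
    exact: RIDstore_pset.
  exact: EX.
- apply: RIDg_pset => //; apply/RIDl_sub; split=> //.
  apply: EX => /= q vq; apply: (RIDstore_poverride SX TX).
  by exists v => //; exists l.
- apply: RIDg_pset => //; apply/RIDl_sub; split=> //.
    by apply: RIDstore_pset => //; move: eX; rewrite subUset => -[].
  exact: EX.
- apply: RIDg_pset; first apply: RIDg_pset => //.
  + by apply/RIDl_sub; split=> //; apply: EX => /= _ ->; apply: NX.
  + exact: NX.
  apply/RIDl_sub; rewrite RIDstore_pempty; split=> //.
  exact: RIDstore_poverride.
- have [S' [v sq]] := jn; apply: RIDg_premove; apply: RIDg_pset => //.
  have /RIDl_sub[_ T'X _] := subset_trans (RIDg_at sq) sX.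
  apply/RIDl_sub; split=> //; first exact: RIDstore_poverride.
  exact: EX.
- by move=> q' [[?]|[? [?]]].
Qed.

Lemma perform_LIDg r s act L : enabled r s act L ->
  LIDg (perform r act s) `<=` LIDg s `|` new_lid act.
Proof.
case=> sr eff _ _ jn; set X := _ `|` _.
have sX : LIDg s `<=` X by move=> l; left.
have NX : new_lid act `<=` X by move=> l; right.
have LX := subset_trans (LIDg_at sr) sX.
have [_ _ substL] := subst_ok.
clearbody X; case: eff LX jn NX {sr} => [S T E x e v|S T E e1 e2|S T E e1 e2|S T E v l
       |S T E l v STl|S T E l v [v' STl]|S T E e q|S T E q T'|S T E q];
  move=> /LIDl_sub[SX TX /LIDe_plug[/= eX EX]] jn NX.
- apply: LIDg_pset => //; apply/LIDl_sub; split=> //.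
  move: eX; rewrite subUset => -[eX vX].
  by apply: EX; apply: subset_trans (substL _ _ _) _; rewrite subUset.
- apply: LIDg_pset => //; apply/LIDl_sub; split=> //.
  by move: eX; rewrite !subUset => -[[_ e1X] _]; apply: EX.
- apply: LIDg_pset => //; apply/LIDl_sub; split=> //.
  by move: eX; rewrite !subUset => -[_ e2X]; apply: EX.
- apply: LIDg_pset => //; apply/LIDl_sub; split=> //.
    by apply: LIDstore_pset => //; apply: NX.
  by apply: EX => /= _ ->; apply: NX.
- apply: LIDg_pset => //; apply/LIDl_sub; split=> //.
  apply: EX => /= q vq; apply: (LIDstore_poverride SX TX).
  by right; exists v => //; exists l.
- apply: LIDg_pset => //; apply/LIDl_sub; split=> //.
    by move: eX; rewrite subUset => -[lX vX]; apply: LIDstore_pset => //; apply: lX.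
  exact: EX.
- apply: LIDg_pset; first apply: LIDg_pset => //.
    by apply/LIDl_sub; split=> //; apply: EX.
  apply/LIDl_sub; rewrite LIDstore_pempty; split=> //.
  exact: LIDstore_poverride.
- have [S' [v sq]] := jn; apply: LIDg_premove; apply: LIDg_pset => //.
  have /LIDl_sub[_ T'X _] := subset_trans (LIDg_at sq) sX.
  apply/LIDl_sub; split=> //; first exact: LIDstore_poverride.
  exact: EX.
- by move=> q' [? [?]].
Qed.

(** * Finiteness of the identifiers of reachable states *)

Lemma finite_new_rid act : finite_set (new_rid act).
Proof.
by case: act => [[l|] L|q L L'|q T L|q];
  exact: finite_set1 || exact: finite_set0.
Qed.

Lemma finite_new_lid act : finite_set (new_lid act).
Proof.
by case: act => [[l|] L|q L L'|q T L|q];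
  exact: finite_set1 || exact: finite_set0.
Qed.

(** An initial state mentions one revision and no location, and each step adds only what it
    allocates. *)
Lemma reachable_finite s : reachable cunit ctrue cfalse subst s ->
  finite_set (RIDg s) /\ finite_set (LIDg s).
Proof.
case=> s0 [[r [e [[eR eL] s0E]]]].
have : finite_set (RIDg s0) /\ finite_set (LIDg s0).
  split.
    apply: (@sub_finite_set _ _ [set r]); last exact: finite_set1.
    rewrite s0E; apply: RIDg_pset => //; first by move=> q [[]|[? []]].
    by rewrite /RIDl /= RIDstore_pempty eR !setU0.
  apply: (@sub_finite_set _ _ set0); last exact: finite_set0.
  rewrite s0E; apply: LIDg_pset => //; first by move=> l [? []].
  by rewrite /LIDl /= LIDstore_pempty eL !setU0.
move=> fin0 st; elim: st fin0 => // {s s0 s0E e eR eL r}.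
  move=> s s' [r /step_enabled[act [L [en ->]]]] [finR finL]; split.
    apply: sub_finite_set (perform_RIDg en) _; rewrite finite_setU.
    by split=> //; exact: finite_new_rid.
  apply: sub_finite_set (perform_LIDg en) _; rewrite finite_setU.
  by split=> //; exact: finite_new_lid.
by move=> s s' s'' _ IH1 _ IH2 /IH1/IH2.
Qed.

(** * Determinism up to fresh identifiers *)

Hypothesis true_false : ctrue <> cfalse.

(** By unique decomposition both actions contract the same redex. Distinctness of the two truth
    values separates the conditionals, and the entry of the joined revision separates joining from
    failing. Only the allocated identifier remains free; both candidates are absent from [s], so
    exchanging them fixes [s]. *)
Lemma enabled_unique r s act L act' L' :
  enabled r s act L -> enabled r s act' L' ->
  exists a b, [/\ bijective a, bijective b, forall q, RIDg s q -> a q = q,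
    forall l, LIDg s l -> b l = l & renamea a b act = act'].
Proof.
move=> [sr eff fr fl jn] [sr' eff' fr' fl' jn'].
have LL : L' = L by move: sr'; rewrite sr => -[].
have same : act = act' ->
    exists a b, [/\ bijective a, bijective b, forall q, RIDg s q -> a q = q,
    forall l, LIDg s l -> b l = l & renamea a b act = act'].
  by move=> <-; exists id, id; split=> //; [exact: id_bij.. | exact: renamea_id].
have fixL a b : bijective a -> bijective b ->
    (forall q, RIDg s q -> a q = q) -> (forall l, LIDg s l -> b l = l) ->
    renamel a b L = L.
  move=> a_bij b_bij fa fb; apply: renamel_fix => // z Lz.
    by apply: fa; apply: RIDg_at Lz; exact: sr.
  by apply: fb; apply: LIDg_at Lz; exact: sr.
move: LL; case: eff' fr' fl' jn' same {sr sr'} =>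
    [S0 T0 E0 x0 e0 v0|S0 T0 E0 e10 e20|S0 T0 E0 e10 e20|S0 T0 E0 v0 l0
    |S0 T0 E0 l0 v0 STl0|S0 T0 E0 l0 v0 STl0|S0 T0 E0 e0 q0
    |S0 T0 E0 q0 T0'|S0 T0 E0 q0] fr' fl' jn' same;
  case: eff fr fl jn fixL same =>
    [S T E x e v|S T E e1 e2|S T E e1 e2|S T E v l|S T E l v STl
    |S T E l v STl|S T E e q|S T E q T'|S T E q] fr fl jn fixL same [];
  move=> ? ? /plug_redex_inj - /(_ isT isT)[?] // [] *; subst;
  try by apply: same.
- have b_bij := swap_bij l l0.
  have fb z : LIDg s z -> swap l l0 z = z.
    by move=> sz; apply: swapD => zE; [case: (fl l)|case: (fl' l0)]; rewrite // -zE.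
  exists id, (swap l l0); split=> //; first exact: id_bij.
  (* The swap fixes [L]; unique decomposition turns this into separate invariance of the stores, the
     context and the stored value. *)
  have := fixL id _ id_bij b_bij (fun _ _ => erefl) fb.
  rewrite /= /renamel /= !renamee_plug => -[SE TE].
  move=> /plug_redex_inj - /(_ isT isT)[EE [vE]].
  by rewrite /= swapL SE EE /rename_store prename_pset // [prename _ _ _]TE vE swapL.
- by apply: same; move: STl0; rewrite STl => -[->].
- have a_bij := swap_bij q q0.
  have fa z : RIDg s z -> swap q q0 z = z.
    by move=> sz; apply: swapD => zE; [case: (fr q)|case: (fr' q0)]; rewrite // -zE.
  exists (swap q q0), id; split=> //; first exact: id_bij.
  have := fixL _ id a_bij id_bij fa (fun _ _ => erefl).
  rewrite /= /renamel /= !renamee_plug => -[SE TE].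
  move=> /plug_redex_inj - /(_ isT isT)[EE [eE]].
  rewrite /= swapL SE TE EE eE /rename_store prename_poverride; last exact: id_bij.
  by rewrite [prename _ _ S]SE [prename _ _ T]TE prename_pempty //; exact: id_bij.
(* Both joins read the same entry of [s], hence record the same local store. *)
- case: jn => S' [v sq]; case: jn' => S0' [v0 sq0].
  by apply: same; move: sq0; rewrite sq => -[_ -> _].
(* A join needs the revision in the domain of [s], a failure needs it outside. *)
- by case: jn' => S' [v sq]; case: jn; exists (LState S' T0' (EVal v)).
- by case: jn => S' [v sq]; case: jn'; exists (LState S' T' (EVal v)).
Qed.

(** The action is renamed by bijections that fix [s], and with it [r] and [L]; equivariance then
    keeps it enabled in the same state. *)
Lemma exists_fresh_action r s act L (X : set Rid) (Y : set Lid) :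
  infinite_set [set: Rid] -> infinite_set [set: Lid] ->
  finite_set (RIDg s) -> finite_set (LIDg s) -> finite_set X -> finite_set Y ->
  enabled r s act L ->
  exists act', [/\ enabled r s act' L, forall q, new_rid act' q -> ~ X q
                 & forall l, new_lid act' l -> ~ Y l].
Proof.
move=> infR infL finR finL finX finY en; have [sr _ fr fl _] := en.
have rid1 q q' : new_rid act q -> new_rid act q' -> q = q'.
  by case: (act) => // ? ? ? -> ->.
have lid1 l l' : new_lid act l -> new_lid act l' -> l = l'.
  by case: (act) => // -[] // ? ? -> ->.
have [a [a_bij fa aX]] := exists_avoiding_bij infR finR finX rid1 fr.
have [b [b_bij fb bY]] := exists_avoiding_bij infL finL finY lid1 fl.
exists (renamea a b act); split.
- have := enabled_rename a_bij b_bij en; rewrite fa; last by left; exists L.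
  rewrite renameg_fix // renamel_fix // => z Lz.
    by apply: fa; apply: RIDg_at Lz; exact: sr.
  by apply: fb; apply: LIDg_at Lz; exact: sr.
- by move=> _ /new_rid_rename[q Nq ->]; apply: aX.
- by move=> _ /new_lid_rename[l Nl ->]; apply: bY.
Qed.

(** * Commutation *)

Definition failing act : bool := if act is AFail _ then true else false.

(** Writes go only to the acting, the forked and the joined revision, and an identifier occurring in
    [s] is not the forked one. Occurrence is asked in place of membership in the domain so that the
    target of a failing join is covered. *)
Lemma perform_frame r s act L q : enabled r s act L -> ~~ failing act ->
  RIDg s q -> q <> r -> ~ joined act q -> perform r act s q = s q.
Proof.
case=> _ _ fr _ _; case: act fr => //= [o L'|q' L' L''|q' T L'] fr _ sq qr jq;
  rewrite /pset ?/premove.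
- by case: asboolP.
- by case: asboolP => [qq'|_]; [case: (fr q')|case: asboolP]; rewrite -?qq'.
- by case: asboolP => // _; case: asboolP.
Qed.

Lemma joined_val r s act L q : enabled r s act L -> joined act q ->
  exists S T v, s q = Some (LState S T (EVal v)).
Proof.
by case=> _ _ _ _; case: act => //= q' T L' [S [v sq]] ->; exists S, T, v.
Qed.

(** A joined revision has reached a value, whereas a revision that can act holds a redex. *)
Lemma enabledN_joined r s act L r' act' L' :
  enabled r s act L -> enabled r' s act' L' -> ~ joined act' r.
Proof.
move=> [sr eff _ _ _] en' /(joined_val en')[S [T [v]]].
by rewrite sr => -[LE]; apply: (effectNval (v := v) eff); rewrite LE.
Qed.

(** Hence a fork, which allocates an identifier not occurring in the state, cannot create the
    revision whose absence makes a join fail. *)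
Lemma effect_fail_rid L q : effect L (AFail q) -> RIDe (current L) q.
Proof.
move=> eff; inversion eff as [| | | | | | | |S T E q' LE qE].
by apply: (RIDe_plug (@subset_refl _ _)).1.
Qed.

(** The action of [r'] leaves untouched both the entry of [r] and the entry that [act] joins or
    fails to join, and it introduces no identifier allocated by [act]. *)
Lemma enabled_frame r s act L r' act' L' : r <> r' ->
  enabled r s act L -> enabled r' s act' L' -> ~~ failing act' ->
  (forall q, new_rid act q -> ~ new_rid act' q) ->
  (forall l, new_lid act l -> ~ new_lid act' l) ->
  (forall q, joined act q -> ~ joined act' q) ->
  enabled r (perform r' act' s) act L.
Proof.
move=> rr' en en' nf dr dl dj; have [sr eff fr fl jn] := en.
have frame := perform_frame en' nf.
split=> //.
- rewrite frame //; first by left; exists L.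
  exact: enabledN_joined en en'.
- by move=> q Nq /(perform_RIDg en')[/fr|/dr]; apply.
- by move=> l Nl /(perform_LIDg en')[/fl|/dl]; apply.
have sr' := enabled_at en'.
case: act en eff jn dj {fr fl dr dl} => //= [q T M|q] en eff jn dj.
  have [S [v sq]] := jn; exists S, v; rewrite frame //.
  - by left; exists (LState S T (EVal v)).
  - by move=> qr'; apply: (enabledN_joined en' en); rewrite -qr'.
  - exact: dj.
have fq : perform r' act' s q = s q.
  apply: frame.
  - by right; exists L; [exists r|right; exact: effect_fail_rid].
  - by move=> qr'; apply: jn; rewrite qr'; exists L'.
  - by move=> /(joined_val en')[S [T [v sq]]]; apply: jn; eexists; exact: sq.
by move=> [M]; rewrite fq => sq; apply: jn; exists M.
Qed.

Lemma perform_comm r s act L r' act' L' : r <> r' ->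
  enabled r s act L -> enabled r' s act' L' ->
  ~~ failing act -> ~~ failing act' ->
  (forall q, new_rid act q -> ~ new_rid act' q) ->
  (forall q, joined act q -> ~ joined act' q) ->
  perform r' act' (perform r act s) = perform r act (perform r' act' s).
Proof.
move=> rr' en en' nf nf' dr dj.
have sr : RIDg s r by left; exists L; exact: enabled_at en.
have sr' : RIDg s r' by left; exists L'; exact: enabled_at en'.
have jr := enabledN_joined en en'; have jr' := enabledN_joined en' en.
have sj q : joined act q -> RIDg s q.
  by move=> /(joined_val en)[S [T [v sq]]]; left; eexists; exact: sq.
have sj' q : joined act' q -> RIDg s q.
  by move=> /(joined_val en')[S [T [v sq]]]; left; eexists; exact: sq.
have fr := enabled_new_rid en; have fr' := enabled_new_rid en'.
apply/funext => q.
case: act {en} nf fr dr dj jr' sj => //= [o M|q1 M M1|q1 T M] _ fr dr dj jr' sj;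
  case: act' {en'} nf' fr' dr dj jr sj' =>
    //= [o' M'|q1' M' M1'|q1' T' M'] _ fr' dr dj jr sj';
  rewrite /pset ?/premove;
  (* Each remaining case lets two written positions coincide. The positions are the actors, which
     are distinct and never joined, the joined revisions, which occur in [s] and differ, and the
     forked ones, which are new and differ. *)
  repeat case: asboolP; move=> // *; subst; exfalso;
  by [|apply: (dr _ erefl)|apply: (dj _ erefl)|apply: jr|apply: jr'
      |apply: (fr _ erefl)|apply: (fr' _ erefl)
      |apply: (fr _ erefl); apply: sj'|apply: (fr' _ erefl); apply: sj].
Qed.

(** The first join removes [q] and leaves the entry of [r'] unchanged, so the same redex of [r'] now
    fails. *)
Lemma step_join_twice r s act L r' act' L' q : r' <> r ->
  enabled r s act L -> enabled r' s act' L' -> joined act q -> joined act' q ->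
  step r' (perform r act s) pempty.
Proof.
move=> r'r en en' jq jq'.
apply: (@enabled_step r' (perform r act s) (AFail q) L'); split=> //.
- have nf : ~~ failing act by case: (act) jq.
  have [sr' _ _ _ _] := en'.
  rewrite (perform_frame en nf) //; first by left; exists L'.
  exact: enabledN_joined en' en.
- have [_ eff _ _ _] := en'; case: act' jq' eff {en'} => //= q' T M -> eff.
  by inversion eff; exact: effect_fail.
- case: act jq {en} => //= q' T M ->; rewrite /premove => -[M'].
  by case: asboolP.
Qed.

Local Notation step_refl r := (clos_refl _ (step r)).

Lemma enabled_diamond r s act L r' act' L' : r <> r' ->
  enabled r s act L -> enabled r' s act' L' ->
  (forall q, new_rid act q -> ~ new_rid act' q) ->
  (forall l, new_lid act l -> ~ new_lid act' l) ->
  exists s', step_refl r' (perform r act s) s' /\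
             step_refl r (perform r' act' s) s'.
Proof.
move=> rr' en en' dr dl.
have nj q : failing act -> ~ joined act q by case: (act) => // ? _ [].
have nj' q : failing act' -> ~ joined act' q by case: (act') => // ? _ [].
have failE r0 act0 s0 : failing act0 -> perform r0 act0 s0 = pempty.
  by case: act0.
have [f|nf] := boolP (failing act); have [f'|nf'] := boolP (failing act').
- by exists pempty; rewrite !failE //; split; exact: r_refl.
(* A failing action gives the empty state from any state, so it only has to stay enabled after the
   other action. *)
- exists pempty; rewrite (failE _ act) //; split; first exact: r_refl.
  apply: r_step; rewrite -(failE r act (perform r' act' s) f).
  by apply: enabled_step (enabled_frame _ en en' _ _ _ _) => // q /nj.
- exists pempty; rewrite (failE _ act') //; split; last exact: r_refl.
  apply: r_step; rewrite -(failE r' act' (perform r act s) f').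
  apply: enabled_step (enabled_frame _ en' en _ _ _ _) => //.
  + by move/esym.
  + by move=> q Nq' /dr.
  + by move=> l Nl' /dl.
  + by move=> q /nj'.
have [[q jq jq']|dj] := pselect (exists2 q, joined act q & joined act' q).
  exists pempty; split; apply: r_step.
    by apply: step_join_twice en en' jq jq' => /esym.
  exact: step_join_twice en' en jq' jq.
have dj1 q : joined act q -> ~ joined act' q by move=> jq jq'; apply: dj; exists q.
exists (perform r' act' (perform r act s)); split; apply: r_step.
  apply: enabled_step (enabled_frame _ en' en _ _ _ _) => //.
  + by move/esym.
  + by move=> q Nq' /dr.
  + by move=> l Nl' /dl.
  + by move=> q jq' /dj1.
rewrite (perform_comm rr' en en') //.
exact: enabled_step (enabled_frame _ en en' _ _ _ _).
Qed.

End Semantics.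

End Calculus.

(** * Local confluence up to renaming *)

Theorem theorem5p2 (Const Var Rid Lid : Type)
  (cunit ctrue cfalse : Const)
  (const_distinct : [/\ cunit <> ctrue, cunit <> cfalse & ctrue <> cfalse])
  (subst : expr Const Var Rid Lid -> Var -> expr Const Var Rid Lid ->
           expr Const Var Rid Lid)
  (subst_ok : substitution subst)
  (Rid_infinite : infinite_set [set: Rid])
  (Lid_infinite : infinite_set [set: Lid])
  (s1 s2 s2' : gstate Const Var Rid Lid) (r r' : Rid)
  (s1_reachable : reachable cunit ctrue cfalse subst s1)
  (s1_s2 : step cunit ctrue cfalse subst r s1 s2)
  (s1_s2' : step cunit ctrue cfalse subst r' s1 s2') :
  exists s3 s3' : gstate Const Var Rid Lid,
    [/\ clos_refl _ (step cunit ctrue cfalse subst r') s2 s3,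
        gequiv s3 s3'
      & clos_refl _ (step cunit ctrue cfalse subst r) s2' s3'].
Proof.
have [_ _ tf] := const_distinct.
have [act [L [en s2E]]] := step_enabled s1_s2.
have [act' [L' [en' s2'E]]] := step_enabled s1_s2'.
have [rr'|rr'] := pselect (r = r').
  (* For a single revision no further step is taken: the two results already agree up to
     renaming. *)
  subst r'; exists s2, s2'; split; [exact: r_refl| |exact: r_refl].
  have [a [b [a_bij b_bij fa fb actE]]] := enabled_unique tf en en'.
  exists a, b; split=> //; rewrite s2E s2'E perform_rename // actE.
  by rewrite renameg_fix // fa //; left; exists L; exact: enabled_at en.
have [finR finL] := reachable_finite subst_ok s1_reachable.
(* [act2] is a variant of [act'] that allocates nothing allocated by [act]. *)
have [act2 [en2 freshR freshL]] := exists_fresh_action subst_ok Rid_infinite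
  Lid_infinite finR finL (finite_new_rid act) (finite_new_lid act) en'.
have [s3 [s2_s3 s2''_s3]] := enabled_diamond subst_ok rr' en en2
  (fun q Nq N2q => freshR q N2q Nq) (fun l Nl N2l => freshL l N2l Nl).
(* This renaming takes [act2] back to [act'] and fixes [s1], so it carries the result of [act2] to
   [s2']. *)
have [a [b [a_bij b_bij fa fb actE]]] := enabled_unique tf en2 en'.
have ar : a r = r by apply: fa; left; exists L; exact: enabled_at en.
have ar' : a r' = r' by apply: fa; left; exists L'; exact: enabled_at en'.
have s2E' : renameg a b (perform r' act2 s1) = s2'.
  by rewrite perform_rename // actE ar' renameg_fix // s2'E.
exists s3, (renameg a b s3); split; [by rewrite s2E| by exists a, b |].
(* The closing step of [r] is renamed into one that starts at [s2']; it remains a step of [r]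
   because [a r = r]. *)
rewrite -s2E'; case: s2''_s3 => [s3' st|]; last exact: r_refl.
by apply: r_step; rewrite -{1}ar; exact: step_rename.
Qed.
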